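(* Let $\tau\in\mathbb{R}$ and let $\widehat{\mathcal{G}_k}(\theta)\in\mathbb{C}^{2\times2}$ be the symbol of the two-grid iteration operator $\mathcal{G}_k=\mathcal{S}_k\mathcal{C}_k\mathcal{S}_k$ (one damped Jacobi pre-smoothing step with damping parameter $\tau$, exact coarse-grid correction, one damped Jacobi post-smoothing step with the same $\tau$) for the one-dimensional Laplace operator, discretized by the Courant element on an infinite uniform grid. Then the convergence rate $$q(\tau):=\sup_{\theta\in[0,2\pi),\ \sin\theta\ne0}\rho\big(\widehat{\mathcal{G}_k}(\theta)\big)$$ (where $\rho$ denotes the spectral radius) is given by $$q(\tau)=\begin{cases}1-4\tau+4\tau^2 & \text{for }\tau<0,\\ 1-2\tau+\tau^2 & \text{for }0\le\tau<\tfrac23,\\ 1-4\tau+4\tau^2 & \text{for }\tfrac23\le\tau,\end{cases}$$ and $q$ takes its minimal value $\tfrac19$ for $\tau=\tfrac23$.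
   Context: Let $h_k>0$ be the fine grid size and $h_{k-1}=2h_k$ the coarse grid size. For $l\in\{k-1,k\}$, $V_l$ is the space of continuous functions on $\mathbb{R}$ that are linear on each interval $[jh_l,(j+1)h_l]$, $j\in\mathbb{Z}$, with nodal basis $\varphi_{l,j}$ ($\varphi_{l,j}(ih_l)=\delta_{ij}$). Functions in $V_l$ are identified with their coefficient sequences indexed by $\mathbb{Z}$. The stiffness matrix $K_l=(\int\varphi_{l,j}'\varphi_{l,i}'\,dx)_{i,j\in\mathbb{Z}}$ is the bi-infinite tridiagonal matrix $\frac1{h_l}\,\mathrm{tridiag}(-1,2,-1)$. The prolongation $P_{k-1}$ is the bi-infinite matrix representing the canonical embedding $V_{k-1}\subset V_k$, i.e. $(P_{k-1}u)_{2j}=u_j$ and $(P_{k-1}u)_{2j+1}=\frac12(u_j+u_{j+1})$; $P_{k-1}^T$ is its transpose. Set $$\mathcal{S}_k=I-\tau(\mathrm{diag}\,K_k)^{-1}K_k,\qquad \mathcal{C}_k=I-P_{k-1}K_{k-1}^{-1}P_{k-1}^TK_k,\qquad \mathcal{G}_k=\mathcal{S}_k\mathcal{C}_k\mathcal{S}_k .$$ For $\theta\in\mathbb{R}$ let $\phi_l(\theta)=(e^{\mathrm{i}j\theta})_{j\in\mathbb{Z}}$. These satisfy $K_l\phi_l(\theta)=\widehat{K_l}(\theta)\phi_l(\theta)$ with $\widehat{K_l}(\theta)=\frac1{h_l}(2-e^{\mathrm{i}\theta}-e^{-\mathrm{i}\theta})$. For $\sin\theta\neq0$, $P_{k-1}$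 maps $\mathrm{span}\{\phi_{k-1}(2\theta)\}$ into $\mathrm{span}\{\phi_k(\theta),\phi_k(\theta+\pi)\}$, $P_{k-1}^T$ maps the latter span into the former, and $K_{k-1}^{-1}$ acts on $\mathrm{span}\{\phi_{k-1}(2\theta)\}$ as multiplication by $\widehat{K_{k-1}}(2\theta)^{-1}$ (note $\widehat{K_{k-1}}(2\theta)\ne0$). Hence $\mathcal{G}_k$ acts on the two-dimensional space $\mathrm{span}\{\phi_k(\theta),\phi_k(\theta+\pi)\}$, and its symbol $\widehat{\mathcal{G}_k}(\theta)$ is the $2\times2$ matrix of this action with respect to the basis $\phi_k(\theta),\phi_k(\theta+\pi)$. *)

(* Defs.v *)
From HB Require Import structures.
From mathcomp Require Import all_boot all_order all_algebra.
From mathcomp Require Import all_classical all_reals all_analysis.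
From mathcomp Require Import complex.
From mathcomp Require Import ring lra.

Set Implicit Arguments.
Unset Strict Implicit.
Unset Printing Implicit Defensive.

Import Order.TTheory GRing.Theory Num.Theory.
Import numFieldNormedType.Exports.

Local Open Scope classical_set_scope.
Local Open Scope ring_scope.
Local Open Scope complex_scope.

Definition bimatrix (R : Type) := int -> int -> R.

Definition bitrmx (R : Type) (A : bimatrix R) : bimatrix R := fun i j => A j i.

(* The sum over [int] is a sum over the support of its summand, which is finite
   for the banded matrices below. *)
Definition biapply (R : realType) (A : bimatrix R) (u : int -> R[i]) :
    int -> R[i] :=
  fun i => \sum_(j \in [set: int]) (A i j)%:C * u j.

Definition P1_space (R : realType) (h : R) : set (R -> R) :=
  [set v | continuous v /\
    forall (j : int) (x : R), j%:~R * h <= x <= (j + 1)%:~R * h ->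
      v x = v (j%:~R * h) +
            (x - j%:~R * h) / h * (v ((j + 1)%:~R * h) - v (j%:~R * h))].

Definition nodal (R : realType) (h : R) (j : int) : R -> R :=
  fun x => Num.max 0 (1 - `|x / h - j%:~R|).

Lemma nodal_grid (R : realType) (h : R) (i j : int) :
  0 < h -> nodal h j (i%:~R * h) = (i == j)%:R.
Proof.
move=> h0; rewrite /nodal mulfK ?(gt_eqF h0)// -rmorphB /= -intr_norm.
have [->|nij] := eqVneq i j; first by rewrite subrr normr0 subr0 max_r.
apply: max_l; rewrite subr_le0 -[1]/(1%:~R) ler_int.
by rewrite -gtz0_ge1 normr_gt0 subr_eq0.
Qed.

Lemma nodal_P1_space (R : realType) (h : R) (j : int) :
  0 < h -> P1_space h (nodal h j).
Proof.
move=> h0; split=> [x|i x xi].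
  have c0 : {for x, continuous (cst 0 : R -> R^o)} by exact: cvg_cst.
  suff c1 : {for x, continuous (fun y : R => 1 - `|y / h - j%:~R| : R^o)}.
    exact: continuous_max c0 c1.
  apply: cvgB; first exact: cvg_cst.
  apply: cvg_norm; apply: cvgB; last exact: cvg_cst.
  by apply: cvgM; [exact: cvg_id|exact: cvg_cst].
rewrite !nodal_grid// /nodal.
have -> : (x - i%:~R * h) / h = x / h - i%:~R.
  by rewrite mulrBl mulfK ?(gt_eqF h0).
have : i%:~R <= x / h <= (i + 1)%:~R.
  by rewrite ler_pdivlMr// ler_pdivrMr.
move: (x / h) => y; rewrite rmorphD /= => /andP[iy yi].
have [ij|ij|ij] := ltgtP i j.
- have : (i + 1)%:~R <= j%:~R :> R by rewrite ler_int -ltzD1 ltrD2r.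
  rewrite rmorphD /= => ij1; rewrite ler0_norm; last by lra.
  have [ij2|ij2] := eqVneq (i + 1) j.
    by rewrite -ij2 rmorphD /= max_r; lra.
  have : (i + 1 + 1)%:~R <= j%:~R :> R.
    by rewrite ler_int -ltzD1 ltrD2r lt_neqAle ij2/= -ltzD1 ltrD2r.
  by rewrite !rmorphD /= => ?; rewrite max_l; lra.
- have : (j + 1)%:~R <= i%:~R :> R by rewrite ler_int -ltzD1 ltrD2r.
  rewrite rmorphD /= => ij1; rewrite ger0_norm; last by lra.
  have -> : (i + 1 == j) = false.
    by apply/negbTE; rewrite gt_eqF// (lt_trans ij)// ltzD1.
  by rewrite max_l /=; lra.
- rewrite -ij ger0_norm ?subr_ge0// max_r; last by lra.
  have -> : (i + 1 == i) = false by apply/negbTE; rewrite gt_eqF// ltzD1.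
  by rewrite /=; lra.
Qed.

Definition stiffness (R : realType) (h : R) : bimatrix R := fun i j =>
  \int[lebesgue_measure]_(x in [set: R])
    (derive1 (nodal h j) x * derive1 (nodal h i) x).

(* [h] is the fine grid size. The coefficient on [nodal h i] of a function in
   [P1_space h] is its value at [i * h], so column [j] represents the coarse
   basis function [nodal (2 * h) j] as an element of [P1_space h]. *)
Definition prolongation (R : realType) (h : R) : bimatrix R := fun i j =>
  nodal (2 * h) j (i%:~R * h).

Lemma prolongation_even (R : realType) (h : R) (i j : int) :
  0 < h -> prolongation h (2 * i) j = (i == j)%:R.
Proof.
move=> h0; rewrite /prolongation rmorphM /= [_ * i%:~R]mulrC -mulrA.
by rewrite nodal_grid// mulr_gt0.
Qed.

Lemma prolongation_odd (R : realType) (h : R) (i j : int) :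
  0 < h -> prolongation h (2 * i + 1) j = ((i == j)%:R + (i + 1 == j)%:R) / 2.
Proof.
move=> h0; have h20 : 0 < 2 * h by rewrite mulr_gt0.
have [_ /(_ i)] := nodal_P1_space j h20.
move=> /(_ ((2 * i + 1)%:~R * h)); rewrite /prolongation => ->.
  rewrite !nodal_grid// rmorphD rmorphM /=.
  have hn0 : h != 0 by rewrite gt_eqF.
  by field.
by rewrite !rmorphD rmorphM /=; apply/andP; split; nra.
Qed.

Definition expi (R : realType) (t : R) : R[i] := cos t +i* sin t.

Definition mode (R : realType) (t : R) : int -> R[i] := fun j =>
  expi (j%:~R * t).

(* The stiffness matrix is not injective on all sequences, so its inverse is
   that of its restriction to the line spanned by [mode t]. *)
Definition stiffness_inv (R : realType) (h t : R) (r : int -> R[i]) :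
    int -> R[i] :=
  xget 0 [set w | (exists a : R[i], w = a *: mode t) /\
                  biapply (stiffness h) w = r].

Definition jacobi (R : realType) (h tau : R) (u : int -> R[i]) : int -> R[i] :=
  fun i => u i - (tau * (stiffness h i i)^-1)%:C * biapply (stiffness h) u i.

(* [t] only enters through the line on which the coarse matrix is inverted. *)
Definition coarse_correction (R : realType) (h t : R) (u : int -> R[i]) :
    int -> R[i] :=
  u - biapply (prolongation h)
        (stiffness_inv (2 * h) (2 * t)
          (biapply (bitrmx (prolongation h)) (biapply (stiffness h) u))).

Definition two_grid (R : realType) (h tau t : R) (u : int -> R[i]) :
    int -> R[i] :=
  jacobi h tau (coarse_correction h t (jacobi h tau u)).

Definition two_modes (R : realType) (t : R) (c : 'cV[R[i]]_2) : int -> R[i] :=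
  c 0 0 *: mode t + c 1 0 *: mode (t + pi).

Definition symbol (R : realType) (h tau t : R) : 'M[R[i]]_2 :=
  xget 0 [set M | forall c : 'cV[R[i]]_2,
            two_grid h tau t (two_modes t c) = two_modes t (M *m c)].

Definition spectral_radius (R : realType) (n : nat) (M : 'M[R[i]]_n) : R :=
  sup [set ComplexField.Normc.normc a | a in [set a : R[i] | eigenvalue M a]].

(* The supremum is taken in the extended reals, where it always exists. *)
Definition convergence_rate (R : realType) (h tau : R) : \bar R :=
  ereal_sup [set (spectral_radius (symbol h tau t))%:E |
    t in [set t | 0 <= t < 2 * pi /\ sin t <> 0]].

(* Main.v *)
(** Write c = cos t. In the basis of the modes t and t + pi, smoothing is
diagonal with entries s1 = 1 - tau (1 - c) and s2 = 1 - tau (1 + c), and the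
coarse-grid correction is the rank one matrix (1, -1)^T (b, -a) with
a = (1 + c) / 2 and b = (1 - c) / 2. So the symbol has rank one, and its only
possibly nonzero eigenvalue is its trace
b s1^2 + a s2^2 = (1 - tau)^2 + c^2 (3 tau^2 - 2 tau), which is nonnegative.
This is affine in c^2, which ranges over [0, 1) when sin t != 0, so the supremum
is the larger of the values at c^2 = 0 (attained) and c^2 = 1 (a limit). *)

Require Import Defs.
From HB Require Import structures.
From mathcomp Require Import all_boot all_order all_algebra.
From mathcomp Require Import all_classical all_reals all_analysis.
From mathcomp Require Import measurable_realfun.
From mathcomp Require Import complex ring lra zify.

Set Implicit Arguments.
Unset Strict Implicit.
Unset Printing Implicit Defensive.

Import Order.TTheory GRing.Theory Num.Theory.
Import numFieldNormedType.Exports.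
Local Open Scope classical_set_scope.
Local Open Scope ring_scope.
Local Open Scope complex_scope.

(** * Derivatives of the nodal functions away from the grid *)

Definition grid (R : realType) (h : R) : set R :=
  range (fun k : int => k%:~R * h).

(** Open, so that an affine formula valid on a cell holds near each of its points and can be
    differentiated there. *)
Definition cell (R : realType) (h : R) (k : int) : set R :=
  `]k%:~R * h, (k + 1)%:~R * h[.

Lemma near_affine_derive1 (R : realType) (f : R -> R) (a b x : R) :
  (\near x, f x = a * x + b) -> derive1 f x = a.
Proof.
move=> fab; rewrite derive1E.
rewrite (near_eq_derive (g := fun y : R => a * y + b))//.
have dab : is_derive x 1 (fun y : R => a * y + b) a.
  by apply: is_derive_eq; rewrite addr0 scaler1.
exact: derive_val.
Qed.

Lemma notin_grid_cell (R : realType) (h : R) (x : R) : 0 < h ->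
  ~ grid h x -> exists n, cell h n x.
Proof.
move=> h0 xG; exists (Num.floor (x / h)).
have /andP[le lt] := floor_itv (x / h).
rewrite /cell /= in_itv /= -(ltr_pdivrMr _ x h0) lt -(ltr_pdivlMr _ x h0) andbT.
rewrite lt_neqAle le andbT; apply/eqP => e; apply: xG.
by exists (Num.floor (x / h)) => //; rewrite e divfK// gt_eqF.
Qed.

Lemma indic_cell (R : realType) (h : R) (n m : int) (x : R) : 0 < h ->
  cell h n x -> \1_(cell h m) x = (n == m)%:R :> R.
Proof.
rewrite /cell indicE mem_setE /= !in_itv/= => h0 /andP[nx xn].
have [<-|nm] := eqVneq n m; first by rewrite nx xn.
case: andP => // -[mx xm].
have := lt_trans nx xm; have := lt_trans mx xn.
rewrite !ltr_pM2r// !ltr_int !ltzD1 => mn nm'.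
by move: nm; rewrite eq_le mn nm'.
Qed.

Lemma derive1_nodal (R : realType) (h : R) (n j : int) (x : R) : 0 < h ->
  cell h n x ->
  derive1 (nodal h j) x = h^-1 * ((n + 1 == j)%:R - (n == j)%:R).
Proof.
move=> h0 xn; set a := RHS.
apply: (@near_affine_derive1 _ _ a ((n == j)%:R - n%:~R * h * a)).
have : \near x, x \in `]n%:~R * h, (n + 1)%:~R * h[ by exact: near_in_itvoo.
apply: filterS => y; rewrite in_itv/= => /andP[ny yn].
have [_ /(_ n y) ->] := nodal_P1_space j h0; last by rewrite !ltW.
by rewrite !nodal_grid// /a; ring.
Qed.

(** * Integration up to countable sets, and the stiffness entries *)

Lemma measurable_cell (R : realType) (h : R) (n : int) :
  measurable (cell h n : set R).
Proof. exact: measurable_itv. Qed.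

Lemma lebesgue_measure_cell (R : realType) (h : R) (n : int) : 0 < h ->
  lebesgue_measure (cell h n : set R) = h%:E.
Proof.
move=> h0; rewrite /cell lebesgue_measure_itv /= lte_fin ltr_pM2r//.
by rewrite ltr_int ltzD1 lexx -EFinD rmorphD /=; congr EFin; ring.
Qed.

Lemma countable_grid (R : realType) (h : R) : countable (grid h).
Proof. exact: sub_countable (card_image_le _ _) (countableP _). Qed.

(** Every subset of a countable set is measurable, so arbitrary values on [N] cannot spoil
    measurability. *)
Lemma measurable_fun_off_countable (R : realType) (N : set R) (f g : R -> R) :
  countable N -> (forall x, ~ N x -> f x = g x) ->
  measurable_fun setT g -> measurable_fun setT f.
Proof.
move=> cN fg mg.
have mN : measurable N by apply: countable_measurable.
rewrite -(setvU N); apply/measurable_funU => //; first exact: measurableC.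
split.
  apply: (eq_measurable_fun g); last exact: measurable_funS mg.
  by move=> x; rewrite inE => xN; rewrite fg.
move=> _ Y mY; apply: countable_measurable => //.
exact: sub_countable (subset_card_le (@subIsetl _ _ _)) cN.
Qed.

Lemma Rintegral_off_countable (R : realType) (N : set R) (f g : R -> R) :
  countable N -> (forall x, ~ N x -> f x = g x) ->
  measurable_fun setT g ->
  \int[lebesgue_measure]_x f x = \int[lebesgue_measure]_x g x.
Proof.
move=> cN fg mg; rewrite /Rintegral; congr fine.
apply: ae_eq_integral => //.
- by apply/measurable_EFinP; apply: measurable_fun_off_countable cN fg mg.
- exact/measurable_EFinP.
- exists N; split; [exact: countable_measurable|
    exact: countable_lebesgue_measure0|].
  move=> x /=; apply: contra_notP => xN _; by rewrite fg.
Qed.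

Lemma Rintegral_cell (R : realType) (h a b : R) (i j : int) : 0 < h ->
  \int[lebesgue_measure]_x (a * \1_(cell h i) x + b * \1_(cell h j) x) =
  h * (a + b).
Proof.
move=> h0.
have ic k : lebesgue_measure.-integrable setT
    (EFin \o (\1_(cell h k) : R -> R)).
  exact: integrable_indic_itv.
have Ic k : \int[lebesgue_measure]_x (\1_(cell h k) x : R) = h.
  rewrite /Rintegral integral_indic//; last exact: measurable_cell.
  rewrite setIT; transitivity (fine h%:E) => //.
  by congr fine; exact: lebesgue_measure_cell.
rewrite RintegralD//; [|exact: (integrableZl measurableT a (ic i))|
  exact: (integrableZl measurableT b (ic j))].
by rewrite !RintegralZl// !Ic; ring.
Qed.

(** The slope of [nodal h j] is [h^-1] on the cell left of node [j], [- h^-1] on the cell right of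
    it and zero on all others, so only these two cells contribute. *)
Lemma stiffnessE (R : realType) (h : R) (i j : int) : 0 < h ->
  stiffness h i j =
    h^-1 * (2 * (i == j)%:R - (i + 1 == j)%:R - (i == j + 1)%:R).
Proof.
move=> h0; rewrite /stiffness.
(* At grid points [derive1 (nodal h j)] may be a junk value. *)
rewrite (@Rintegral_off_countable _ (grid h) _ (fun x =>
  h^-1 ^+ 2 * ((i == j)%:R - (i + 1 == j)%:R) * \1_(cell h (j - 1)) x +
  h^-1 ^+ 2 * ((i == j)%:R - (i == j + 1)%:R) * \1_(cell h j) x)).
- by rewrite Rintegral_cell//; field; rewrite gt_eqF.
- exact: countable_grid.
- move=> x /(notin_grid_cell h0)[n xn].
  rewrite !(derive1_nodal _ h0 xn) !(indic_cell _ h0 xn).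
  rewrite [n == j - 1]eq_sym subr_eq [j == n + 1]eq_sym [i == j + 1]eq_sym.
  have nS k : (k + 1 == k :> int) = false by rewrite gt_eqF// ltzD1.
  (* Node [j] is the right end of the cell, or its left end, or not an end of it at all. *)
  have [<-|nj] := eqVneq (n + 1) j.
    rewrite [n == n + 1]eq_sym nS (inj_eq (addIr 1)) [i == n + 1]eq_sym.
    by rewrite [i == n]eq_sym !(mulr0, mulr1, addr0, subr0) expr2 mulrA.
  have [<-|nj'] := eqVneq n j; last by rewrite !(mulr0, subr0) mul0r addr0.
  rewrite [i == n]eq_sym mulr0 mulr1 sub0r add0r mulrN1 expr2 -mulrA mulNr.
  by rewrite -mulrN -mulrN opprB.
- by apply: measurable_funD; apply: measurable_funM => //;
    apply: measurable_indic; exact: measurable_cell.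
Qed.

Lemma stiffness_diag (R : realType) (h : R) (i : int) : 0 < h ->
  stiffness h i i = 2 / h.
Proof.
move=> h0; rewrite stiffnessE// eqxx.
have -> : (i + 1 == i) = false by lia.
have -> : (i == i + 1) = false by lia.
by rewrite /= !subr0 mulr1 mulrC.
Qed.

(** * Fourier modes and aliasing *)

Lemma expiD (R : realType) (a b : R) : expi (a + b) = expi a * expi b.
Proof.
rewrite /expi cosD sinD; apply/eqP; rewrite eq_complex /= eqxx /=.
by rewrite addrC.
Qed.

Lemma modeD (R : realType) (t : R) (i j : int) :
  mode t (i + j) = mode t i * mode t j.
Proof. by rewrite /mode rmorphD /= mulrDl expiD. Qed.

Lemma expi0 (R : realType) : expi (0 : R) = 1.
Proof. by rewrite /expi cos0 sin0. Qed.

Lemma expiV (R : realType) (t : R) : expi (- t) * expi t = 1.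
Proof. by rewrite -expiD addNr expi0. Qed.

Lemma expi_cos (R : realType) (t : R) : expi t + expi (- t) = (2 * cos t)%:C.
Proof.
rewrite /expi cosN sinN; apply/eqP; rewrite eq_complex /= subrr eqxx andbT.
by rewrite mulr_natl mulr2n.
Qed.

Lemma mode0 (R : realType) (t : R) : mode t 0 = 1.
Proof. by rewrite /mode mul0r expi0. Qed.

Lemma mode_double (R : realType) (t : R) (i : int) :
  mode t (2 * i) = mode (2 * t) i.
Proof. by rewrite /mode rmorphM /= [_ * i%:~R]mulrC -mulrA. Qed.

Lemma mode2pi (R : realType) (i : int) : mode (2 * pi : R) i = 1.
Proof.
have m1 : mode (2 * pi : R) 1 = 1.
  by rewrite /mode mul1r mulr_natl /expi cos2pi sin2pi.
have mN n : mode (2 * pi : R) (n%:Z) = 1.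
  by elim: n => [|n IH]; rewrite ?mode0// intS modeD IH m1 mulr1.
case: i => n; first exact: mN.
(* The value at a negative index is the inverse of the value at the opposite index, which is 1. *)
have := modeD (2 * pi : R) (Negz n) n.+1; rewrite mN mulr1 => <-.
by rewrite NegzE addNr mode0.
Qed.

Lemma mode_addpi (R : realType) (t : R) (i : int) :
  mode (t + pi) i = mode t i * mode pi i.
Proof. by rewrite /mode mulrDr expiD. Qed.

(** Aliasing: the modes [t] and [t + pi] differ by the factor [mode pi], which is 1 at even nodes
    and -1 at odd ones. *)
Lemma mode_addpi_even (R : realType) (t : R) (i : int) :
  mode (t + pi) (2 * i) = mode (2 * t) i.
Proof. by rewrite mode_addpi !mode_double mode2pi mulr1. Qed.

Lemma mode_pi1 (R : realType) : mode (pi : R) 1 = -1.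
Proof.
rewrite /mode mul1r /expi cospi sinpi.
by apply/eqP; rewrite eq_complex /= oppr0 !eqxx.
Qed.

Lemma mode_addpi_odd (R : realType) (t : R) (i : int) :
  mode (t + pi) (2 * i + 1) = - mode t (2 * i + 1).
Proof.
rewrite mode_addpi [mode pi _]modeD mode_double mode2pi mul1r mode_pi1.
by rewrite mulrN1.
Qed.

(** * Rows of banded matrices as explicit finite sums *)

Lemma biapplyE (R : realType) (A : bimatrix R) (u : int -> R[i]) (i : int)
  (r : seq int) : uniq r -> (forall j, j \notin r -> A i j = 0) ->
  biapply A u i = \sum_(j <- r) (A i j)%:C * u j.
Proof.
move=> ur Ar; rewrite /biapply (fsbigE r)//=; last first.
  by move=> j _ /Ar ->; rewrite mul0r.
by apply: eq_bigl => j; rewrite in_setT.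
Qed.

(** * Spectral radius of a rank one matrix *)

(** Eigenvectors are rows here: multiplying [v u w = a v] by [u] on the right gives [a b = b (w u)]
    with [b = v u], and [b] can be cancelled when [a] is nonzero. *)
Lemma eigenvalue_rank1 (F : fieldType) (n : nat) (u : 'cV[F]_n.+1)
    (w : 'rV[F]_n.+1) (a : F) :
  eigenvalue (u *m w) a -> a = 0 \/ a = (w *m u) 0 0.
Proof.
move=> /eigenvalueP[v]; rewrite mulmxA [v *m u]mx11_scalar mul_scalar_mx.
move=> vE v0; have [->|a0] := eqVneq a 0; [by left|right].
set b := (v *m u) 0 0 in vE *.
have : a * b = b * (w *m u) 0 0.
  have := congr1 (mulmx^~ u) vE; rewrite -!scalemxAl => /matrixP/(_ 0 0).
  by rewrite mxE [RHS]mxE => ->.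
have b0 : b != 0.
  apply: contra_neq v0 => b0; move: vE; rewrite b0 scale0r => /esym/eqP.
  by rewrite scaler_eq0 (negbTE a0) => /eqP.
by rewrite mulrC => /(mulfI b0).
Qed.

(** The row [w] is itself an eigenvector; if it vanishes, the matrix is zero and any nonzero row
    serves. *)
Lemma rank1_eigenvalue (F : fieldType) (n : nat) (u : 'cV[F]_n.+1)
    (w : 'rV[F]_n.+1) : eigenvalue (u *m w) ((w *m u) 0 0).
Proof.
apply/eigenvalueP; have [->|w0] := eqVneq w 0; last first.
  by exists w => //; rewrite mulmxA {1}[w *m u]mx11_scalar mul_scalar_mx.
exists (const_mx 1); first by rewrite !mulmx0 mul0mx mxE scale0r.
by apply/eqP => /matrixP/(_ 0 0)/eqP; rewrite !mxE oner_eq0.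
Qed.

(** Every eigenvalue is 0 or [r], and [r] occurs, so [r] is the largest modulus; its occurrence also
    makes the set nonempty, as [sup] requires. *)
Lemma spectral_radius_rank1 (R : realType) (n : nat) (u : 'cV[R[i]]_n.+1)
    (w : 'rV[R[i]]_n.+1) (r : R) : 0 <= r -> (w *m u) 0 0 = r%:C ->
  spectral_radius (u *m w) = r.
Proof.
move=> r0 wur; have nr : ComplexField.Normc.normc r%:C = r.
  by rewrite /= expr0n addr0 sqrtr_sqr ger0_norm.
rewrite /spectral_radius; set E := (X in sup X).
have Er : E r by exists r%:C => //=; rewrite -wur; exact: rank1_eigenvalue.
have rE : ubound E r.
  move=> _ [a /= /eigenvalue_rank1[->|->] <-].
    by rewrite ComplexField.Normc.normc0.
  by rewrite wur nr.
apply/eqP; rewrite eq_le; apply/andP; split.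
  by apply: ge_sup => //; exists r.
by apply: sup_upper_bound => //; split; exists r.
Qed.

(** * Nodewise action of stiffness, prolongation and restriction *)

Lemma biapply_stiffness (R : realType) (h : R) (u : int -> R[i]) (i : int) :
  0 < h -> biapply (stiffness h) u i =
    (h^-1)%:C * (2 * u i - u (i + 1) - u (i - 1)).
Proof.
move=> h0; have [i1 i2] : i + 1 != i /\ i + 1 + 1 != i by lia.
rewrite (@biapplyE _ _ _ _ [:: i; i + 1; i - 1]); first last.
- move=> j; rewrite !inE => jN; rewrite stiffnessE//.
  have [-> [-> ->]] : (i == j) = false /\ (i + 1 == j) = false /\
    (i == j + 1) = false by lia.
  by rewrite /=; ring.
- by rewrite /= !inE; lia.
rewrite !big_cons big_nil !stiffnessE// !eqxx.
have -> : (i == i + 1) = false by lia.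
have -> : (i + 1 == i) = false by lia.
have -> : (i == i + 1 + 1) = false by lia.
have -> : (i == i - 1) = false by lia.
have -> : (i + 1 == i - 1) = false by lia.
have -> : (i == i - 1 + 1) = true by lia.
by rewrite /=; ring.
Qed.

Lemma biapply_prolongation_even (R : realType) (h : R) (u : int -> R[i])
  (i : int) : 0 < h -> biapply (prolongation h) u (2 * i) = u i.
Proof.
move=> h0; rewrite (@biapplyE _ _ _ _ [:: i]) ?big_seq1//.
  by rewrite prolongation_even// eqxx mul1r.
by move=> j; rewrite inE prolongation_even// eq_sym => /negbTE ->.
Qed.

Lemma biapply_prolongation_odd (R : realType) (h : R) (u : int -> R[i])
  (i : int) : 0 < h ->
  biapply (prolongation h) u (2 * i + 1) = (u i + u (i + 1)) / 2.
Proof.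
move=> h0; rewrite (@biapplyE _ _ _ _ [:: i; i + 1]); first last.
- move=> j; rewrite !inE prolongation_odd// => jN.
  have [-> ->] : (i == j) = false /\ (i + 1 == j) = false by lia.
  by rewrite /= add0r mul0r.
- by rewrite /= !inE; lia.
rewrite !big_cons big_nil !prolongation_odd// !eqxx.
have -> : (i == i + 1) = false by lia.
have -> : (i + 1 == i) = false by lia.
by rewrite /=; field.
Qed.

Lemma int_parity (j : int) : exists k : int, j = 2 * k \/ j = 2 * k + 1.
Proof. by exists (j %/ 2)%Z; lia. Qed.

Lemma biapply_restriction (R : realType) (h : R) (u : int -> R[i])
  (i : int) : 0 < h ->
  biapply (bitrmx (prolongation h)) u i =
    u (2 * i) + (u (2 * i + 1) + u (2 * (i - 1) + 1)) / 2.
Proof.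
move=> h0.
(* Column [i] of the prolongation is supported on the fine node [2 * i] and its two neighbours; the
   left one is written in the odd form. *)
rewrite (@biapplyE _ _ _ _ [:: 2 * i; 2 * i + 1; 2 * (i - 1) + 1]); first last.
- move=> j; rewrite !inE /bitrmx; have [k [->|->]] := int_parity j => jN.
    rewrite prolongation_even//.
    by have -> : (k == i) = false by lia.
  rewrite prolongation_odd//.
  have [-> ->] : (k == i) = false /\ (k + 1 == i) = false by lia.
  by rewrite /= add0r mul0r.
- by rewrite /= !inE; lia.
rewrite !big_cons big_nil /bitrmx prolongation_even// !prolongation_odd// !eqxx.
have -> : (i + 1 == i) = false by lia.
have -> : (i - 1 == i) = false by lia.
have -> : (i - 1 + 1 == i) = true by lia.
by rewrite /=; field.
Qed.

(** * Action of the operators on the span of two modes *)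

(** The function of [two_modes] with its coefficients as separate arguments, so that operators
    compose by rewriting. *)
Definition modes (R : realType) (t : R) (p q : R[i]) : int -> R[i] :=
  fun i => p * mode t i + q * mode (t + pi) i.

Lemma mode_modes (R : realType) (t : R) (a : R[i]) :
  a *: mode t = modes t a 0.
Proof. by apply/funext => i; rewrite /modes mul0r addr0. Qed.

Lemma modes_even (R : realType) (t : R) (p q : R[i]) (i : int) :
  modes t p q (2 * i) = (p + q) * mode (2 * t) i.
Proof. by rewrite /modes mode_addpi_even mode_double -mulrDl. Qed.

Lemma mode1 (R : realType) (t : R) : mode t 1 = expi t.
Proof. by rewrite /mode mul1r. Qed.

Lemma modeN1 (R : realType) (t : R) : mode t (-1) = expi (- t).
Proof. by congr expi; exact: mulN1r. Qed.

Lemma modes_odd (R : realType) (t : R) (p q : R[i]) (i : int) :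
  modes t p q (2 * i + 1) = (p - q) * mode (2 * t) i * expi t.
Proof.
by rewrite /modes mode_addpi_odd modeD mode_double mode1; ring.
Qed.

(** Both sides are the fine mode at the odd node just left of [2 * i], recentred at coarse node
    [i]. *)
Lemma mode_double_pred (R : realType) (t : R) (i : int) :
  mode (2 * t) (i - 1) * expi t = mode (2 * t) i * expi (- t).
Proof.
rewrite modeD -mulrA; congr (_ * _).
by rewrite modeN1 -expiD; congr expi; ring.
Qed.

Lemma laplace_mode (R : realType) (t : R) (i : int) :
  2 * mode t i - mode t (i + 1) - mode t (i - 1) =
    (2 - 2 * cos t)%:C * mode t i.
Proof.
by rewrite !modeD mode1 modeN1 rmorphB /= -expi_cos; ring.
Qed.

Lemma stiffness_modes (R : realType) (h t : R) (p q : R[i]) : 0 < h ->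
  biapply (stiffness h) (modes t p q) =
  modes t ((h^-1 * (2 - 2 * cos t))%:C * p) ((h^-1 * (2 + 2 * cos t))%:C * q).
Proof.
move=> h0; apply/funext => i; rewrite biapply_stiffness// /modes.
transitivity ((h^-1)%:C *
    (p * (2 * mode t i - mode t (i + 1) - mode t (i - 1)) +
     q * (2 * mode (t + pi) i - mode (t + pi) (i + 1) -
          mode (t + pi) (i - 1)))).
  by ring.
by rewrite !laplace_mode cosDpi mulrN opprK !(rmorphM _ h^-1) /=; ring.
Qed.

Lemma jacobi_modes (R : realType) (h tau t : R) (p q : R[i]) : 0 < h ->
  jacobi h tau (modes t p q) =
  modes t ((1 - tau * (1 - cos t))%:C * p) ((1 - tau * (1 + cos t))%:C * q).
Proof.
move=> h0; apply/funext => i.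
rewrite /jacobi stiffness_modes// stiffness_diag//.
have hn0 : h != 0 by rewrite gt_eqF.
have -> : 1 - tau * (1 - cos t) =
    1 - tau * (2 / h)^-1 * (h^-1 * (2 - 2 * cos t)) by field.
have -> : 1 - tau * (1 + cos t) =
    1 - tau * (2 / h)^-1 * (h^-1 * (2 + 2 * cos t)) by field.
rewrite !(rmorphB, rmorph1) /= !(rmorphM _ (_ * _^-1)) /= /modes; ring.
Qed.

(** The even node contributes [p + q]; the mean of its odd neighbours, with phases [expi t] and
    [expi (- t)], turns into [cos t] times [p - q], and both neighbours enter with weight 1/2. *)
Lemma restriction_modes (R : realType) (h t : R) (p q : R[i]) : 0 < h ->
  biapply (bitrmx (prolongation h)) (modes t p q) =
  ((1 + cos t)%:C * p + (1 - cos t)%:C * q) *: mode (2 * t).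
Proof.
move=> h0; apply/funext => i; rewrite biapply_restriction//.
rewrite modes_even !modes_odd -(mulrA _ (mode _ (i - 1))) mode_double_pred.
have -> : ((p - q) * mode (2 * t) i * expi t +
   (p - q) * (mode (2 * t) i * expi (- t))) / 2 =
   (p - q) * mode (2 * t) i * (cos t)%:C.
  by rewrite mulrA -mulrDr expi_cos rmorphM /=; field.
by rewrite -[RHS]/(_ * _) [(1 - _)%:C]rmorphB [(1 + _)%:C]rmorphD /=; ring.
Qed.

(** Parity forces the coefficients: their sum is [a] by the even nodes, and their difference is
    [a * cos t] by the odd ones, where averaging 1 and [expi (2 * t)] gives [expi t * cos t]. *)
Lemma prolongation_mode (R : realType) (h t : R) (a : R[i]) : 0 < h ->
  biapply (prolongation h) (a *: mode (2 * t)) =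
  modes t (a * ((1 + cos t) / 2)%:C) (a * ((1 - cos t) / 2)%:C).
Proof.
move=> h0; apply/funext => i; have [k [->|->]] := int_parity i.
  rewrite biapply_prolongation_even// modes_even -mulrDr -rmorphD /=.
  have -> : (1 + cos t) / 2 + (1 - cos t) / 2 = 1 by field.
  by rewrite rmorph1 mulr1.
rewrite biapply_prolongation_odd// modes_odd -mulrBr -rmorphB /=.
have -> : (1 + cos t) / 2 - (1 - cos t) / 2 = (2 * cos t) / 2 by field.
rewrite rmorphM /= -expi_cos fmorphV rmorph_nat.
have -> : (a *: mode (2 * t)) (k + 1) =
    a * (mode (2 * t) k * (expi t * expi t)).
  have -> : expi t * expi t = mode (2 * t) 1.
    by rewrite mode1 -expiD; congr expi; ring.
  by rewrite -modeD.
rewrite -[(_ *: _) k]/(a * mode (2 * t) k).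
have := expiV t => e.
transitivity
  (a * mode (2 * t) k * (expi t * expi t + expi (- t) * expi t) / 2);
  last by field.
by rewrite e; field.
Qed.

Lemma cos_double (R : realType) (t : R) : cos (2 * t) = 2 * cos t ^+ 2 - 1.
Proof. by rewrite mulr_natl cos_mulr2n mulr_natl. Qed.

Lemma stiffness_inv_mode (R : realType) (h t : R) (b : R[i]) : 0 < h ->
  cos t != 1 ->
  stiffness_inv h t (b *: mode t) = (b / (h^-1 * (2 - 2 * cos t))%:C) *: mode t.
Proof.
move=> h0 ct; set l := (X in _ / X).
have l0 : l != 0.
  rewrite /l fmorph_eq0 mulf_neq0//; first by rewrite invr_eq0 gt_eqF.
  by apply: contra_neq ct => ?; lra.
have K a : biapply (stiffness h) (a *: mode t) = (l * a) *: mode t.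
  by rewrite !mode_modes stiffness_modes// mulr0.
(* The eigenvalue [l] is nonzero, so the line contains exactly one preimage and [xget] must return
   it. *)
apply: xget_subset1.
  by split; [exists (b / l)|rewrite K mulrCA divff// mulr1].
move=> w1 w2 [[a1 ->] +] [[a2 ->]]; rewrite !K => <- e; congr (_ *: _).
have := congr1 (fun f => f 0) e.
rewrite -[LHS]/(_ * mode t 0) -[RHS]/(_ * mode t 0) mode0 !mulr1.
by move/(mulfI l0).
Qed.

Lemma sin_neq0_cos2 (R : realType) (t : R) : sin t != 0 -> 1 - cos t ^+ 2 != 0.
Proof. by rewrite -sin2cos2 sqrf_eq0. Qed.

(** The coarse solution has coefficient [p + q], the one that the function itself has at even nodes.
    The corrected function thus vanishes at all even nodes, whence the opposite coefficients. *)
Lemma coarse_correction_modes (R : realType) (h t : R) (p q : R[i]) : 0 < h ->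
  sin t != 0 ->
  let d := ((1 - cos t) / 2)%:C * p - ((1 + cos t) / 2)%:C * q in
  coarse_correction h t (modes t p q) = modes t d (- d).
Proof.
move=> h0 /sin_neq0_cos2 st d; rewrite /coarse_correction stiffness_modes//.
rewrite restriction_modes// stiffness_inv_mode ?mulr_gt0//; last first.
  by rewrite cos_double; apply: contra_neq st => ?; lra.
rewrite prolongation_mode//.
set a := (X in modes t (X * _)); rewrite -/a.
have -> : a = p + q.
  rewrite /a !mulrA -!rmorphM /= cos_double.
  have hn0 : h != 0 by rewrite gt_eqF.
  (* Restricting the stiffness eigenvalue of either mode yields the coarse eigenvalue at [2 * t], so
     the quotient is 1. *)
  have -> : (1 + cos t) * (h^-1 * (2 - 2 * cos t)) =
    (2 * h)^-1 * (2 - 2 * (2 * cos t ^+ 2 - 1)) by field.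
  have -> : (1 - cos t) * (h^-1 * (2 + 2 * cos t)) =
    (2 * h)^-1 * (2 - 2 * (2 * cos t ^+ 2 - 1)) by field.
  rewrite -mulrDr mulrAC divff ?mul1r// fmorph_eq0 mulf_neq0//.
    by rewrite invr_eq0 mulf_neq0.
  by apply: contra_neq st => ?; lra.
apply/funext => i; rewrite -[LHS]/(_ - _) /modes /d.
rewrite !(rmorphM _ _ (2^-1)) /= rmorphB rmorphD /= fmorphV rmorph_nat.
by field.
Qed.

(** * The symbol and its spectral radius *)

Lemma two_modes_modes (R : realType) (t : R) (c : 'cV_2) :
  two_modes t c = modes t (c 0 0) (c 1 0).
Proof. by []. Qed.

(** Nodes 0 and 1 recover [p + q] and [p - q], the latter up to the invertible phase [expi t]. *)
Lemma modes_inj (R : realType) (t : R) (p q p' q' : R[i]) :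
  modes t p q = modes t p' q' -> p = p' /\ q = q'.
Proof.
move=> e.
have := congr1 (fun f => f (2 * 0)) e; rewrite !modes_even !mode0 !mulr1 => e0.
have := congr1 (fun f => f (2 * 0 + 1) * expi (- t)) e.
rewrite /= !modes_odd !mode0 !mulr1 -!mulrA [expi t * _]mulrC expiV !mulr1.
move=> e1.
have pE (a b : R[i]) : a = ((a + b) + (a - b)) / 2 by field.
have qE (a b : R[i]) : b = ((a + b) - (a - b)) / 2 by field.
by split; [rewrite (pE p q) e0 e1 -pE|rewrite (qE p q) e0 e1 -qE].
Qed.

(** The row reads off the coefficient [d] of the coarse correction after pre-smoothing; the column
    is the post-smoothed direction (1, -1). *)
Lemma symbolE (R : realType) (h tau t : R) : 0 < h -> sin t != 0 ->
  let s1 := 1 - tau * (1 - cos t) in let s2 := 1 - tau * (1 + cos t) in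
  symbol h tau t =
    (\col_(i < 2) (if i == 0 then s1 else - s2)%:C) *m
    (\row_(j < 2) (if j == 0 then (1 - cos t) / 2 * s1
                   else - ((1 + cos t) / 2 * s2))%:C).
Proof.
move=> h0 st s1 s2; apply: xget_subset1 => /=.
  move=> c; rewrite two_modes_modes /two_grid jacobi_modes//.
  rewrite coarse_correction_modes// jacobi_modes// -/s1 -/s2 two_modes_modes.
  rewrite -mulmxA !mxE !big_ord_recl !big_ord0 !mxE.
  rewrite !big_ord_recl !big_ord0 !mxE /=.
  rewrite -[c ord0 0]/(c 0 0) (_ : lift ord0 ord0 = 1); last exact: val_inj.
  by congr modes; rewrite !rmorphN !(rmorphM _ _ s1) !(rmorphM _ _ s2) /=; ring.
(* Uniqueness: independence of the modes makes both matrices agree on the unit vectors. *)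
move=> M M' MP M'P; apply/matrixP => i j.
have : M *m delta_mx j 0 = M' *m delta_mx j 0 :> 'cV_2.
  have := MP (delta_mx j 0); rewrite M'P !two_modes_modes => /modes_inj[e0 e1].
  apply/matrixP => k l; rewrite [l]ord1; have [->|k0] := eqVneq k 0 => //.
  by have -> : k = 1 by case: k k0 => [[|[]]]// ? _; exact/val_inj.
by rewrite -!colE => /matrixP/(_ i 0); rewrite !mxE.
Qed.

Lemma spectral_radius_symbol (R : realType) (h tau t : R) : 0 < h ->
  sin t != 0 ->
  spectral_radius (symbol h tau t) =
    (1 - tau) ^+ 2 + cos t ^+ 2 * (3 * tau ^+ 2 - 2 * tau).
Proof.
move=> h0 st; have := cos_geN1 t; have := cos_le1 t; move=> c1 cN1.
rewrite symbolE//; apply: spectral_radius_rank1.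
  (* Nonnegativity becomes visible as a combination of squares with weights that are nonnegative
     because [cos t] lies between -1 and 1. *)
  have -> : (1 - tau) ^+ 2 + cos t ^+ 2 * (3 * tau ^+ 2 - 2 * tau) =
    (1 - cos t) / 2 * (1 - tau * (1 - cos t)) ^+ 2 +
    (1 + cos t) / 2 * (1 - tau * (1 + cos t)) ^+ 2 by field.
  by rewrite addr_ge0// mulr_ge0 ?sqr_ge0//; lra.
rewrite !mxE !big_ord_recl big_ord0 !mxE /= addr0 -!rmorphM -rmorphD /=.
by congr (_%:C); field.
Qed.

(** * The supremum over the frequencies *)

Lemma convergence_rateE (R : realType) (h tau : R) : 0 < h ->
  convergence_rate h tau =
    (Num.max ((1 - tau) ^+ 2) ((1 - 2 * tau) ^+ 2))%:E.
Proof.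
move=> h0; set a := (1 - tau) ^+ 2; set D := 3 * tau ^+ 2 - 2 * tau.
have -> : (1 - 2 * tau) ^+ 2 = a + D by rewrite /a /D; ring.
apply/eqP; rewrite eq_le; apply/andP; split.
  apply: ge_ereal_sup => _ [t [_ /eqP st] <-].
  rewrite spectral_radius_symbol// -/a -/D lee_fin le_max.
  have [D0|D0] := leP D 0; apply/orP; [left|right].
    by rewrite gerDl mulr_ge0_le0// sqr_ge0.
  by rewrite lerD2l ger_pMl.
(* Here [x] stands for the squared cosine, realised by [acos (Num.sqrt x)]; its sine is nonzero
   since [x < 1]. *)
have sup_ge x : 0 <= x < 1 -> ((a + x * D)%:E <= convergence_rate h tau)%E.
  move=> /andP[x0 x1].
  have s01 : 0 <= Num.sqrt x < 1.
    by rewrite sqrtr_ge0 -[ltRHS]sqrtr1 ltr_sqrt.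
  have s1 : -1 <= Num.sqrt x <= 1 by lra.
  have sx : sin (acos (Num.sqrt x)) != 0.
    by rewrite sin_acos// sqr_sqrtr// gt_eqF// sqrtr_gt0 subr_gt0.
  apply: ereal_sup_ubound; exists (acos (Num.sqrt x)).
    split; last exact/eqP.
    rewrite acos_ge0//= (le_lt_trans (acos_lepi s1))//.
    by have := pi_gt0 R; lra.
  by rewrite spectral_radius_symbol// acosK ?in_itv//= sqr_sqrtr.
rewrite EFin_max ge_max; apply/andP; split.
  by have := @sup_ge 0; rewrite mul0r addr0; apply; rewrite lexx ltr01.
(* The value at [x = 1] lies outside the admissible range, so it is bounded up to an arbitrary
   positive [e]. *)
apply/lee_addgt0Pr => e e0.
have eD : 0 < e + `|D| by rewrite ltr_wpDr.
(* The point x = |D| / (e + |D|) satisfies D (1 - x) <= e. *)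
have x01 : 0 <= `|D| / (e + `|D|) < 1.
  by rewrite divr_ge0 ?(ltW eD)//= ltr_pdivrMr// mul1r ltrDr.
apply: le_trans (leeD (sup_ge _ x01) (lexx e%:E)).
rewrite -EFinD lee_fin -addrA lerD2l -lerBlDl.
have -> : D - `|D| / (e + `|D|) * D = D / (e + `|D|) * e.
  by field; rewrite gt_eqF.
rewrite ler_piMl ?(ltW e0)// ler_pdivrMr// mul1r.
by rewrite (le_trans (ler_norm D))// lerDr ltW.
Qed.

(** * The piecewise formula and the optimal damping *)

Theorem mainTheorem2 (R : realType) (h : R) (h_gt0 : 0 < h) :
  (forall tau : R,
     convergence_rate h tau =
       (if tau < 0 then 1 - 4 * tau + 4 * tau ^+ 2
        else if tau < 2 / 3 then 1 - 2 * tau + tau ^+ 2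
        else 1 - 4 * tau + 4 * tau ^+ 2)%:E) /\
  (convergence_rate h (2 / 3) = (1 / 9)%:E /\
   forall tau : R, (convergence_rate h (2 / 3) <= convergence_rate h tau)%E).
Proof.
have rate23 : convergence_rate h (2 / 3) = (1 / 9)%:E.
  rewrite convergence_rateE//; congr EFin.
  by rewrite max_l; [field|nra].
split=> [tau|].
  rewrite convergence_rateE//; congr EFin.
  (* The second square minus the first is [tau * (3 * tau - 2)], so the larger one changes at 0 and
     at 2/3. *)
  have [tau0|tau0] := ltP tau 0; first by rewrite max_r; [ring|nra].
  have [tau23|tau23] := ltP tau (2 / 3); first by rewrite max_l; [ring|nra].
  by rewrite max_r; [ring|nra].
split; first exact: rate23.
move=> tau; rewrite rate23 convergence_rateE// lee_fin le_max.
(* On each side of 2/3 one of the squares alone is already at least 1/9. *)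
have [tau23|tau23] := leP tau (2 / 3); apply/orP; [left|right].
  rewrite -subr_ge0 (_ : _ - _ = (2 / 3 - tau) * (4 / 3 - tau)); last by field.
  by apply: mulr_ge0; lra.
rewrite -subr_ge0 (_ : _ - _ = (2 * tau - 4 / 3) * (2 * tau - 2 / 3)).
  by apply: mulr_ge0; lra.
by field.
Qed.
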